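(* Let $\Omega\subset\mathbb{R}^n$ be a bounded domain and let $G$ be an N-function with $g=G'$ such that, for some constants $p^\pm$, $1<p^-\le \frac{t g(t)}{G(t)}\le p^+<\infty$ for all $t>0$. Let $$\lambda_0:=\inf_{u\in W^{2,G}_0(\Omega),\,u\neq0}\frac{\int_\Omega g(|\Delta u|)|\Delta u|\,dx}{\int_\Omega g(|u|)|u|\,dx}.$$ Let $r>0$ and let $\lambda_r\in\mathbb{R}$ be any eigenvalue of $$\Delta_g^2u_r=\lambda_r\frac{g(|u_r|)}{|u_r|}u_r\ \text{ in }\Omega,\qquad u_r\in W^{2,G}_0(\Omega),\qquad \int_\Omega G(u_r)\,dx=r,$$ i.e. such that there is a weak solution $u_r$ of this problem. Then $\lambda_r\in[\lambda_0,\infty)$.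
   Context: An N-function is an even function $G:\mathbb{R}\to[0,\infty)$ of the form $G(t)=\int_0^t g(s)\,ds$, where $g$ is odd, continuous, non-decreasing, $g(0)=0$, $g(t)>0$ for $t>0$, and $g(t)\to\infty$ as $t\to\infty$. The biharmonic $g$-Laplacian is formally $\Delta_g^2u=\Delta\left(\frac{g(|\Delta u|)}{|\Delta u|}\Delta u\right)$; expressions $\frac{g(|w|)}{|w|}w$ are understood as $0$ where $w=0$. A weak solution $u_r\in W^{2,G}_0(\Omega)$ is one satisfying $\int_\Omega \frac{g(|\Delta u_r|)}{|\Delta u_r|}\Delta u_r\,\Delta v\,dx=\lambda_r\int_\Omega\frac{g(|u_r|)}{|u_r|}u_r\,v\,dx$ for all $v\in W^{2,G}_0(\Omega)$ (together with the constraint $\int_\Omega G(u_r)\,dx=r$). $L^G(\Omega)$ is the space of measurable $u:\Omega\to\mathbb{R}$ with $\int_\Omega G(u)\,dx<\infty$, with the Luxemburg norm $\|u\|_G=\inf\{\lambda>0:\int_\Omega G(u/\lambda)\,dx\le 1\}$. $W^{2,G}(\Omega)$ is the space of $u$ whose distributional derivatives $D^\alpha u$, $|\alpha|\le 2$, all lie in $L^G(\Omega)$, with norm $\sum_{|\alpha|\le 2}\|D^\alpha u\|_G$, and $W^{2,G}_0(\Omega)$ is the closure of $C_0^\infty(\Omega)$ in it, equipped with the (equivalent) norm $\|u\|_{2,G}:=\|\Delta u\|_G$. Standing assumptions on $G$: $\int_0^1 \frac{G^{-1}(s)}{s^{(n+1)/n}}ds<\infty$ and $\int_1^\infty \frac{G^{-1}(s)}{s^{(n+1)/n}}ds=\infty$.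 *)

(* Defs.v *)
From HB Require Import structures.
From mathcomp Require Import all_boot all_order all_algebra.
From mathcomp Require Import all_classical all_reals all_analysis measurable_realfun.

Set Implicit Arguments.
Unset Strict Implicit.
Unset Printing Implicit Defensive.

Import Order.TTheory GRing.Theory Num.Theory.
Import numFieldNormedType.Exports.

Local Open Scope classical_set_scope.
Local Open Scope ring_scope.

Section borel_rV.
Context {R : realType} (n : nat).

Let salg : set (set 'rV[R]_n) := <<s [set A | open A] >>.
Let salg0 : salg set0. Proof. exact: sigma_algebra0. Qed.
Let salgC A : salg A -> salg (~` A). Proof. exact: sigma_algebraC. Qed.
Let salgU (F : (set 'rV[R]_n)^nat) :
  (forall i, salg (F i)) -> salg (\bigcup_i F i).
Proof. exact: sigma_algebra_bigcup. Qed.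

(* R^n carries its Borel sigma-algebra. *)
HB.instance Definition _ :=
  @isMeasurable.Build default_measure_display 'rV[R]_n salg salg0 salgC salgU.

Lemma open_measurable_rV (A : set 'rV[R]_n) : open A -> measurable A.
Proof. by move=> oA; exact: sub_sigma_algebra. Qed.

Lemma ballrVE (x y : 'rV[R]_n) (e : R) : 0 < e ->
  ball x e y <-> forall j, ball (x ord0 j) e (y ord0 j).
Proof.
move=> e0; split => [[_ h] j|h]; first exact: h.
by split => // i j; rewrite (ord1 i); exact: h.
Qed.

Let ratball (q : 'rV[rat]_n * nat) : set 'rV[R]_n :=
  ball (map_mx (@ratr R) q.1 : 'rV[R]_n) q.2.+1%:R^-1.

Lemma open_rV_bigcup (A : set 'rV[R]_n) : open A ->
  A = \bigcup_q (if `[< ratball q `<=` A >] then ratball q else set0).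
Proof.
move=> oA; apply/seteqP; split => [x Ax|x [q _]]; last first.
  by case: asboolP => // qA qx; exact: qA.
have /nbhs_ballP[e /= e0 eA] := open_nbhs_nbhs (conj oA Ax).
have [k] := @ltr_add_invr R 0 (e / 2) (divr_gt0 e0 (ltr0n _ 2)).
rewrite add0r => ke.
have k0 : (0 : R) < k.+1%:R^-1 by rewrite invr_gt0.
have /choice[f fP] : forall j : 'I_n, exists q : rat,
    ball (ratr q : R) k.+1%:R^-1 (x ord0 j).
  move=> j; have /rat_in_itvoo[q] :
      x ord0 j - k.+1%:R^-1 < x ord0 j + k.+1%:R^-1 by rewrite ltrD2l gtrN.
  rewrite in_itv/= => /andP[q1 q2]; exists q.
  by rewrite /ball/= ltr_distlC; apply/andP; split; rewrite ?ltrBlDr// -ltrBlDr.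
have rx : ratball (\row_j f j, k) x.
  by apply/ballrVE => // j; rewrite !mxE; exact: fP.
exists (\row_j f j, k) => //; case: asboolP => //; case => y ry.
apply: eA; rewrite [e]splitr.
apply: (@ball_triangle _ _ (map_mx (@ratr R) (\row_j f j) : 'rV[R]_n)).
  by apply: ball_sym; apply: le_ball rx; exact: ltW.
by apply: le_ball ry; exact: ltW.
Qed.

End borel_rV.

Section lebesgue_rVS.
Context {R : realType} (n : nat).

Definition cons_rV (p : R * 'rV[R]_n) : 'rV[R]_n.+1 :=
  \row_i oapp (p.2 ord0) p.1 (unlift ord0 i).

Let cons_rV0 p : cons_rV p ord0 ord0 = p.1.
Proof. by rewrite mxE unlift_none. Qed.

Let cons_rVS p j : cons_rV p ord0 (lift ord0 j) = p.2 ord0 j.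
Proof. by rewrite mxE liftK. Qed.

Lemma measurable_cons_rV : measurable_fun setT cons_rV.
Proof.
apply: (@measurability _ _ (R * 'rV[R]_n)%type 'rV[R]_n.+1 setT cons_rV
    [set A | open A]) => // _ [A oA <-].
rewrite setTI (open_rV_bigcup oA) preimage_bigcup.
apply: countable_bigcupT_measurable => [|q]; first exact: countableP.
case: asboolP => _; last by rewrite preimage_set0.
set c : 'rV[R]_n.+1 := map_mx _ _; set e := _^-1.
have e0 : 0 < e by rewrite invr_gt0.
rewrite (_ : _ @^-1` _ =
  ball (c ord0 ord0) e `*` ball (\row_j c ord0 (lift ord0 j)) e).
  apply: measurableX; first exact: measurable_ball.
  by apply: open_measurable_rV; exact: ball_open.
apply/seteqP; split => -[x v] /=.
  move=> /(ballrVE _ _ e0) h; split; first by have := h ord0; rewrite cons_rV0.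
  apply/(ballrVE _ _ e0) => j; have := h (lift ord0 j).
  by rewrite cons_rVS mxE.
move=> [hx /(ballrVE _ _ e0) hv]; apply/(ballrVE _ _ e0) => j.
have [j' ->|->] := unliftP ord0 j; last by rewrite cons_rV0.
by rewrite cons_rVS; have := hv j'; rewrite mxE.
Qed.

Let uncons_rV (v : 'rV[R]_n.+1) : R * 'rV[R]_n :=
  (v ord0 ord0, \row_j v ord0 (lift ord0 j)).

Let cons_rVK : cancel cons_rV uncons_rV.
Proof.
move=> [x v]; congr pair; first exact: cons_rV0.
by apply/rowP => j; rewrite mxE cons_rVS.
Qed.

Let measurable_uncons_rV : measurable_fun setT uncons_rV.
Proof.
apply: measurable_fun_pair.
  apply: (@measurability _ _ 'rV[R]_n.+1 (measurableTypeR R) _ _ _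
    (RGenOpens.measurableE R)).
  move=> _ [_ [a [b ->]] <-]; rewrite setTI; apply: open_measurable_rV.
  by apply: open_comp => [v _|]; [exact: coord_continuous|exact: interval_open].
apply: (@measurability _ _ 'rV[R]_n.+1 'rV[R]_n _ _ [set A | open A]) =>
    // _ [A oA <-].
rewrite setTI; apply: open_measurable_rV; apply: open_comp => // v _.
move=> B /nbhs_ballP[e /= e0 eB]; apply/nbhs_ballP; exists e => //= w vw.
apply: eB; apply/ballrVE => // j; rewrite !mxE.
by have /(ballrVE _ _ e0) := vw; exact.
Qed.

Context (m : {sigma_finite_measure set 'rV[R]_n -> \bar R}).

Definition cons_measure : set 'rV[R]_n.+1 -> \bar R :=
  pushforward (@lebesgue_measure R \x m)%E cons_rV.

Let nu : {measure set 'rV[R]_n.+1 -> \bar R} :=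
  measure_function_pushforward__canonical__measure_function_Measure
    (@lebesgue_measure R \x m)%E measurable_cons_rV.

HB.instance Definition _ := isMeasure.Build _ _ _ cons_measure
  (measure0 nu) (measure_ge0 nu) (@measure_semi_sigma_additive _ _ _ nu).

Let cons_measure_sigma_finite : sigma_finite setT cons_measure.
Proof.
have /sigma_finiteP[F [TF ndF Foo]] := sigma_finiteT (@lebesgue_measure R).
have /sigma_finiteP[H [TH ndH Hoo]] := sigma_finiteT m.
exists (fun k => uncons_rV @^-1` (F k `*` H k)) => [|k].
  rewrite -preimage_bigcup (_ : \bigcup_k _ = setT) ?preimage_setT//.
  apply/seteqP; split => // -[x v] _.
  have [i _ Fx] : (\bigcup_k F k) x by rewrite -TF.
  have [j _ Hv] : (\bigcup_k H k) v by rewrite -TH.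
  exists (maxn i j) => //; split => /=.
    by move: x Fx; exact/subsetPset/ndF/leq_maxl.
  by move: v Hv; exact/subsetPset/ndH/leq_maxr.
have [mF Fk] := Foo k; have [mH Hk] := Hoo k.
split.
  rewrite -[_ @^-1` _]setTI; apply: measurable_uncons_rV => //.
  exact: measurableX.
rewrite /cons_measure /pushforward -comp_preimage.
rewrite (_ : _ \o _ = id); last by apply/funext => p; exact: cons_rVK.
rewrite preimage_id [ltLHS]product_measure1E//.
by rewrite lte_mul_pinfty// ge0_fin_numE.
Qed.

HB.instance Definition _ := Measure_isSigmaFinite.Build _ _ _ cons_measure
  cons_measure_sigma_finite.

End lebesgue_rVS.

(* n-dimensional Lebesgue measure, as the n-fold product of the
   one-dimensional one *)
Fixpoint lebesgue_rV {R : realType} (n : nat) :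
    {sigma_finite_measure set 'rV[R]_n -> \bar R} :=
  match n with
  | 0 => @dirac _ 'rV[R]_0 0 R
  | n.+1 => cons_measure (lebesgue_rV n)
  end.

(* Functions on a domain Om are total functions on R^n whose values outside
   Om are irrelevant; equality of functions is almost everywhere on Om. *)
Section orlicz_sobolev.
Context {R : realType}.
Implicit Types (G g : R -> R).

(* g is the density of G; since G is even and g odd, the formula for G t with
   t < 0 follows from the one for t >= 0. *)
Record n_function G g : Prop := {
  n_function_ge0 : forall t, 0 <= G t ;
  n_function_even : forall t, G (- t) = G t ;
  n_function_int : forall t, 0 <= t ->
    G t = \int[@lebesgue_measure R]_(s in `[0, t]) g s ;
  n_function_odd : forall t, g (- t) = - g t ;
  n_function_continuous : continuous g ;
  n_function_nondecreasing : {homo g : s t / s <= t} ;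
  n_function_density0 : g 0 = 0 ;
  n_function_gt0 : forall t, 0 < t -> 0 < g t ;
  n_function_cvg : g t @[t --> +oo%R] --> +oo%R }.

(* inverse of the restriction of G to [0, +oo[ *)
Definition n_function_inv G : R -> R := pinv (`[0, +oo[%classic : set R) G.

Context {n : nat}.
Local Notation mu := (lebesgue_rV n).
Implicit Types (Om : set 'rV[R]_n) (u v w phi : 'rV[R]_n -> R).

Definition partial (i : 'I_n) phi : 'rV[R]_n -> R := 'D_(delta_mx ord0 i) phi.

Definition smooth phi := forall (s : seq 'I_n) x,
  differentiable (foldr partial phi s) x.

(* phi belongs to C_0^oo(Om) *)
Definition test_function Om phi :=
  [/\ smooth phi, compact (closure [set x | phi x != 0]) &
      closure [set x | phi x != 0] `<=` Om].

Definition mi_order (a : 'I_n -> nat) := (\sum_i a i)%N.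

Definition partials (a : 'I_n -> nat) phi : 'rV[R]_n -> R :=
  foldr (fun i => iter (a i) (partial i)) phi (enum 'I_n).

Definition locally_integrable_rV Om u := measurable_fun Om u /\
  forall K, K `<=` Om -> compact K ->
    (\int[mu]_(x in K) `|u x|%:E < +oo)%E.

Definition is_weak_partials Om (a : 'I_n -> nat) u w :=
  [/\ locally_integrable_rV Om u, locally_integrable_rV Om w &
    forall phi, test_function Om phi ->
      \int[mu]_(x in Om) (u x * partials a phi x) =
      (-1) ^+ mi_order a * \int[mu]_(x in Om) (w x * phi x)].

(* the distributional derivative of u of multi-index a: it is unique up to
   equality almost everywhere on Om, and junk if it does not exist as a
   locally integrable function *)
Definition weak_partials Om (a : 'I_n -> nat) u : 'rV[R]_n -> R :=
  xget (cst 0) [set w | is_weak_partials Om a u w].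

Definition weak_laplacian Om u : 'rV[R]_n -> R := fun x =>
  \sum_(i < n) weak_partials Om (fun j => if j == i then 2 else 0)%N u x.

Definition orlicz G Om u := measurable_fun Om u /\
  (\int[mu]_(x in Om) (G (u x))%:E < +oo)%E.

Definition luxemburg G Om u : \bar R := ereal_inf [set l%:E | l in
  [set l : R | 0 < l /\ (\int[mu]_(x in Om) (G (u x / l))%:E <= 1)%E]].

Definition sobolev2 G Om u := forall a, (mi_order a <= 2)%N ->
  (exists w, is_weak_partials Om a u w) /\ orlicz G Om (weak_partials Om a u).

(* Entries of a multi-index of order at most 2 are at most 2. *)
Definition sobolev2_norm G Om u : \bar R :=
  (\sum_(a : {ffun 'I_n -> 'I_3} | (mi_order (fun i => a i) <= 2)%N)
     luxemburg G Om (weak_partials Om (fun i => a i) u))%E.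

(* closure of C_0^oo(Om) in W^{2,G}(Om) *)
Definition sobolev2_0 G Om u := sobolev2 G Om u /\
  forall e : R, 0 < e -> exists2 phi, test_function Om phi &
    (sobolev2_norm G Om (u \- phi)%R < e%:E)%E.

(* All the integrals below are finite when t * g t / G t is bounded; at 0 the
   quotient g `|t| / `|t| * t is 0. *)
Definition lambda0 G g Om : R := inf [set q | exists u,
  [/\ sobolev2_0 G Om u, ~ {ae mu, forall x, Om x -> u x = 0} &
    q = (\int[mu]_(x in Om)
           (g `|weak_laplacian Om u x| * `|weak_laplacian Om u x|)) /
        (\int[mu]_(x in Om) (g `|u x| * `|u x|))]].

Definition weak_solution G g Om (r lam : R) u :=
  [/\ sobolev2_0 G Om u,
    (\int[mu]_(x in Om) (G (u x))%:E = r%:E)%E &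
    forall v, sobolev2_0 G Om v ->
      \int[mu]_(x in Om)
        (g `|weak_laplacian Om u x| / `|weak_laplacian Om u x| *
         weak_laplacian Om u x * weak_laplacian Om v x) =
      lam * \int[mu]_(x in Om) (g `|u x| / `|u x| * u x * v x)].

Definition eigenvalue_biharmonic G g Om (r lam : R) :=
  exists u, weak_solution G g Om r lam u.

End orlicz_sobolev.

(* Main.v *)
Require Import Defs.
From mathcomp Require Import all_boot all_order all_algebra.
From mathcomp Require Import all_classical all_reals all_analysis.
From mathcomp Require Import measurable_realfun.

Import Order.TTheory GRing.Theory Num.Theory.
Import numFieldNormedType.Exports.

Local Open Scope classical_set_scope.
Local Open Scope ring_scope.

(** Testing the weak formulation with [v = u_r] itself turns it into
    [\int g(|Delta u_r|) |Delta u_r| = lambda_r * \int g(|u_r|) |u_r|].  Once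
    the integral on the right is known to be finite and nonzero, [lambda_r] is
    the Rayleigh quotient of [u_r], hence at least the infimum [lambda_0] of
    all Rayleigh quotients, which are nonnegative.

    The integral on the right is controlled by the constraint: the growth
    condition gives [p^- G(u) <= g(|u|) |u| <= p^+ G(u)] pointwise
    ([n_function_growth]), so that the integral lies between [p^- r] and
    [p^+ r] ([weighted_integral_bounds]).  The constraint also prevents [u_r]
    from vanishing almost everywhere, because [G(0) = 0]. *)

Section n_function_theory.
Context {R : realType} {G g : R -> R} (GN : n_function G g).

Lemma n_function0 : G 0 = 0.
Proof. by rewrite (n_function_int GN)// set_itv1 Rintegral_set1. Qed.

Lemma n_function_density_ge0 t : 0 <= t -> 0 <= g t.
Proof.
by move=> t0; rewrite -(n_function_density0 GN); exact: (n_function_nondecreasing GN).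
Qed.

Lemma n_function_abs t : G `|t| = G t.
Proof.
by have [_|_] := ger0P t; rewrite ?(n_function_even GN).
Qed.

Lemma n_function_le s t : 0 <= s -> s <= t -> G s <= G t.
Proof.
move=> s0 st; have t0 := le_trans s0 st.
have mg D : measurable_fun D (EFin \o g).
  apply/measurable_EFinP; apply: measurable_funTS.
  exact: continuous_measurable_fun (n_function_continuous GN).
have gfin (a : R) :
    (\int[@lebesgue_measure R]_(x in `[0%R, a]) (g x)%:E \is a fin_num)%E.
  apply: integrable_fin_num => //; apply: continuous_compact_integrable.
    exact: segment_compact.
  exact: continuous_subspaceT (n_function_continuous GN).
rewrite !(n_function_int GN)//; apply: fine_le => //.
apply: ge0_subset_integral => //.
- exact: mg.
- by move=> x /=; rewrite in_itv/= lee_fin => /andP[? _]; exact: n_function_density_ge0.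
- by move=> x /=; rewrite !in_itv/= => /andP[-> xs]; rewrite (le_trans xs).
Qed.

(** [G] is the composite of the absolute value with the monotone function
    that agrees with [G] on the nonnegative half-line and vanishes before. *)
Lemma measurable_n_function : measurable_fun setT G.
Proof.
have -> : G = (fun t => G (Num.max 0 t)) \o (fun t => `|t|).
  by apply/funext => t /=; rewrite max_r// n_function_abs.
apply: measurableT_comp; last exact: normr_measurable.
apply: nondecreasing_measurable => // s t st.
apply: n_function_le; first by rewrite le_max lexx.
by rewrite ge_max !le_max lexx/= st orbT.
Qed.

Lemma measurable_density_weight : measurable_fun setT (fun t : R => g `|t| * `|t|).
Proof.
have mg := continuous_measurable_fun (n_function_continuous GN).
apply: measurable_funM; last exact: normr_measurable.
by apply: (measurableT_comp mg); exact: normr_measurable.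
Qed.

Lemma density_weight_ge0 (t : R) : 0 <= g `|t| * `|t|.
Proof. by rewrite mulr_ge0// n_function_density_ge0. Qed.

(** The integrand of the weak formulation tested with the solution itself is
    the one of the Rayleigh quotient, also where the solution vanishes. *)
Lemma density_weightE (t : R) : g `|t| / `|t| * t * t = g `|t| * `|t|.
Proof.
have [->|t0] := eqVneq t 0; first by rewrite normr0 !mulr0.
by rewrite -mulrA -expr2 -real_normK ?num_real// expr2 mulrA divfK ?normr_eq0.
Qed.

Context {pminus pplus : R} (pminus_gt0 : 0 < pminus)
  (growth : forall t, 0 < t -> pminus <= t * g t / G t <= pplus).

(** To clear the denominator one needs [G t > 0] away from [0].  The lower bound
    gives it: a zero denominator makes the quotient [0], which is less than
    [pminus]. *)
Lemma n_function_growth (t : R) :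
  pminus * G t <= g `|t| * `|t| <= pplus * G t.
Proof.
have [->|t0] := eqVneq t 0; first by rewrite n_function0 normr0 !mulr0 lexx.
have nt0 : 0 < `|t| by rewrite normr_gt0.
have /andP[lo hi] := growth _ nt0; rewrite n_function_abs in lo hi.
have Gt0 : 0 < G t.
  rewrite lt_neqAle (n_function_ge0 GN) andbT eq_sym; apply/eqP => G0.
  by move: lo; rewrite G0 invr0 mulr0 leNgt pminus_gt0.
by move: lo hi; rewrite ler_pdivlMr// ler_pdivrMr// (mulrC `|t|) => -> ->.
Qed.

Section integrals.
Context {d : measure_display} {T : measurableType d}
  (mu : {measure set T -> \bar R}) {D : set T} (mD : measurable D)
  {u : T -> R} (um : measurable_fun D u).

Let mGu : measurable_fun D (fun x => (G (u x))%:E).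
Proof.
by apply/measurable_EFinP; exact: (measurableT_comp measurable_n_function).
Qed.

(** In extended reals, so that finiteness of the weighted integral follows from
    finiteness of the integral of [G u].  The factor [pplus] can be taken out
    because the growth condition at any point forces it above [pminus]. *)
Lemma weighted_integral_bounds :
  (pminus%:E * \int[mu]_(x in D) (G (u x))%:E <=
     \int[mu]_(x in D) (g `|u x| * `|u x|)%:E <=
   pplus%:E * \int[mu]_(x in D) (G (u x))%:E)%E.
Proof.
have mw : measurable_fun D (fun x => (g `|u x| * `|u x|)%:E).
  by apply/measurable_EFinP; exact: (measurableT_comp measurable_density_weight).
have pp : 0 <= pplus.
  by have /andP[lo /(le_trans lo)] := growth _ ltr01; apply: le_trans; exact: ltW.
have G0 x : D x -> (0 <= (G (u x))%:E)%E.
  by move=> _; rewrite lee_fin (n_function_ge0 GN).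
rewrite -!ge0_integralZl_EFin//; last exact: ltW.
apply/andP; split; apply: ge0_le_integral => //.
- by move=> x Dx; rewrite mule_ge0 ?G0// lee_fin ltW.
- exact: measurable_funeM.
- by move=> x _; rewrite -EFinM lee_fin; case/andP: (n_function_growth (u x)).
- by move=> x _; rewrite lee_fin density_weight_ge0.
- exact: measurable_funeM.
- by move=> x _; rewrite -EFinM lee_fin; case/andP: (n_function_growth (u x)).
Qed.

Lemma ae0_n_function_integral0 : {ae mu, forall x, D x -> u x = 0} ->
  (\int[mu]_(x in D) (G (u x))%:E = 0)%E.
Proof.
move=> u0; rewrite -(integral0 mu D); apply: ge0_ae_eq_integral => //.
- by move=> x _; rewrite lee_fin (n_function_ge0 GN).
- by apply: filterS u0 => x ux0 Dx; rewrite ux0// n_function0.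
Qed.

End integrals.
End n_function_theory.

(** A weak derivative of order [0] requires the function itself to be locally
    integrable, whence measurability. *)
Lemma sobolev2_measurable (R : realType) (n : nat) (G : R -> R)
    (Om : set 'rV[R]_n) (u : 'rV[R]_n -> R) :
  sobolev2 G Om u -> measurable_fun Om u.
Proof.
move=> /(_ (fun=> 0%N)); rewrite /mi_order big1// => -[]// [w [[um _] _ _]] _.
exact: um.
Qed.

Theorem proposition5p6 (R : realType) (n : nat) (Om : set 'rV[R]_n)
    (G g : R -> R) (pminus pplus r lam : R)
    (n_gt0 : (0 < n)%N)
    (Om_bounded : bounded_set Om) (Om_open : open Om)
    (Om_connected : connected Om) (Om_nonempty : Om !=set0)
    (GN : n_function G g)
    (G_int0 : (\int[@lebesgue_measure R]_(s in `]0%R, 1%R])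
      (n_function_inv G s / s `^ (n.+1%:R / n%:R))%:E < +oo)%E)
    (G_int1 : (\int[@lebesgue_measure R]_(s in `[1%R, +oo[)
      (n_function_inv G s / s `^ (n.+1%:R / n%:R))%:E = +oo)%E)
    (pminus_gt1 : 1 < pminus)
    (growth : forall t, 0 < t -> pminus <= t * g t / G t <= pplus)
    (r_gt0 : 0 < r)
    (lam_eigen : eigenvalue_biharmonic G g Om r lam) :
  lam \in `[lambda0 G g Om, +oo[.
Proof.
have [u [u0 ur weak]] := lam_eigen.
have mOm : measurable Om by exact: open_measurable_rV.
have um : measurable_fun Om u by exact: (sobolev2_measurable _ _ G Om u u0.1).
have pm0 : 0 < pminus by exact: lt_trans ltr01 pminus_gt1.
have := weighted_integral_bounds GN pm0 growth (lebesgue_rV n) mOm um.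
rewrite ur -!EFinM => /andP[lo hi].
pose B := \int[lebesgue_rV n]_(x in Om) (g `|u x| * `|u x|).
have B0 : B != 0.
  rewrite gt_eqF// fine_gt0// (lt_le_trans _ lo) ?lte_fin ?mulr_gt0//=.
  by rewrite (le_lt_trans hi) ?ltry.
have lamE : lam = (\int[lebesgue_rV n]_(x in Om)
    (g `|weak_laplacian Om u x| * `|weak_laplacian Om u x|)) / B.
  have := weak u u0.
  under eq_Rintegral do rewrite (density_weightE (g := g)).
  under [X in _ = _ * X]eq_Rintegral do rewrite (density_weightE (g := g)).
  by move=> ->; rewrite mulfK.
rewrite in_itv/= andbT; apply: ge_inf.
  exists 0 => _ [v [_ _ ->]].
  by rewrite divr_ge0//; apply: Rintegral_ge0 => x _; exact: (density_weight_ge0 GN).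
exists u; split => // uae.
have := ae0_n_function_integral0 GN (lebesgue_rV n) mOm um uae.
by rewrite ur => -[] /eqP; rewrite gt_eqF.
Qed.
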